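(* For either choice of source divergence, $\mathcal J$ is $\frac{\beta_{\min}}{\rho_2}$-strongly convex on $\mathbb R^n$. At its global minimizer $\mathbf g^\star$, the local condition number satisfies $$\kappa\big(\nabla^2\mathcal J(\mathbf g^\star)\big)\le\frac{\beta_{\max}}{\beta_{\min}}\Big(1+\frac{\max_k\{\rho_2-g_k^\star\}}{\varepsilon}\Big).$$
   Context: $\mathcal X,\mathcal Y$ are Polish spaces, $\mu$ is a finite nonnegative measure on $\mathcal X$, $\nu=\sum_{j=1}^n\beta_j\delta_{y_j}$ with $y_1,\dots,y_n\in\mathcal Y$, $\beta_j>0$, and $b/n\le\beta_j\le B/n$ for constants $0<b\le B$; $\beta_{\min}=\min_j\beta_j$, $\beta_{\max}=\max_j\beta_j$. The cost $c:\mathcal X\times\mathcal Y\to[0,\infty)$ is continuous, and $\varepsilon,\rho_1,\rho_2>0$. For $x\in\mathcal X$, $\mathbf g\in\mathbb R^n$: $B_j(x,\mathbf g)=\beta_j\exp\big(\tfrac{g_j-c(x,y_j)}{\varepsilon}\big)$ and $Z(x,\mathbf g)=\sum_{j=1}^nB_j(x,\mathbf g)$. The semi-dual objective of entropic unbalanced optimal transport (with $\chi^2$ target penalty) is $$\mathcal J(\mathbf g)=\mathcal J_{\mathrm{trans}}(\mathbf g)+\sum_{j=1}^n\beta_j\Big(\frac{g_j^2}{2\rho_2}-g_j\Big),$$ where: - KL source: $\mathcal J_{\mathrm{trans}}(\mathbf g)=(\rho_1+\varepsilon)\int_{\mathcal X}Z(x,\mathbf g)^\alpha d\mu(x)$,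 with $\alpha=\frac{\varepsilon}{\varepsilon+\rho_1}$; - $\chi^2$ source: $\mathcal J_{\mathrm{trans}}(\mathbf g)=\frac{\varepsilon^2}{\rho_1}\int_{\mathcal X}\big(W(U(x,\mathbf g))+\tfrac12W(U(x,\mathbf g))^2\big)d\mu(x)$, with $U(x,\mathbf g)=\frac{\rho_1}{\varepsilon}e^{\rho_1/\varepsilon}Z(x,\mathbf g)$ and $W$ the Lambert function (inverse of $z\mapsto ze^z$ on $[0,\infty)$). The condition number of an $L$-smooth, $\gamma$-strongly convex function is $L/\gamma$; accordingly $\kappa(H)=\lambda_{\max}(H)/\lambda_{\min}(H)$ for a symmetric positive definite matrix $H$. *)

(* Defs.v *)
From HB Require Import structures.
From mathcomp Require Import all_boot all_order all_algebra.
From mathcomp Require Import all_classical all_reals all_analysis.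

Set Implicit Arguments.
Unset Strict Implicit.
Unset Printing Implicit Defensive.

Import Order.TTheory GRing.Theory Num.Theory.
Import numFieldNormedType.Exports.

Local Open Scope classical_set_scope.
Local Open Scope ring_scope.

Definition polish (R : realType) (T : topologicalType) : Prop :=
  (exists2 D : set T, countable D & dense D) /\
  exists d : T -> T -> R,
    [/\ (forall x y, d x y = 0 <-> x = y),
        (forall x y, d x y = d y x),
        (forall x y z, d x z <= d x y + d y z),
        (forall x (A : set T),
          nbhs x A <-> exists2 e : R, 0 < e & [set y | d x y < e] `<=` A) &
        (forall u : nat -> T,
          (forall e : R, 0 < e -> exists N : nat, forall i j : nat,
            (N <= i)%N -> (N <= j)%N -> d (u i) (u j) < e) ->
          exists l : T, u @ \oo --> l)].

(* Borel sigma-algebra: measurable types in the library are inhabited, hence X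
   is a ptopologicalType wherever it carries a measure. *)
Notation borel X := (g_sigma_algebraType (@open X)).

Section FiniteExtrema.
Variables (R : realType) (m : nat).

(* The seed is one of the values, so it does not affect the result. *)
Definition fmin (f : 'I_m.+1 -> R) : R := \big[Num.min/f ord0]_j f j.
Definition fmax (f : 'I_m.+1 -> R) : R := \big[Num.max/f ord0]_j f j.

End FiniteExtrema.

Section Calculus.
Variables (R : realType) (m : nat).
Implicit Types (J : 'rV[R]_m.+1 -> R) (g : 'rV[R]_m.+1) (H : 'M[R]_m.+1).

(* The norm on 'rV[R]_m.+1 in the library is the sup norm, so the squared
   Euclidean norm is spelled out. *)
Definition sqnorm2 g : R := \sum_j g 0 j ^+ 2.

Definition strongly_convex (gamma : R) J : Prop :=
  forall (g h : 'rV[R]_m.+1) (t : R), 0 <= t <= 1 ->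
    J (t *: g + (1 - t) *: h) <=
      t * J g + (1 - t) * J h - gamma / 2 * t * (1 - t) * sqnorm2 (g - h).

Definition global_minimizer J g : Prop := forall h, J g <= J h.

Definition partial J (i : 'I_m.+1) : 'rV[R]_m.+1 -> R :=
  fun g => 'D_(delta_mx 0 i) J g.

Definition gradient J g : 'rV[R]_m.+1 := \row_j partial J j g.

Definition twice_differentiable J g : Prop :=
  (\forall h \near g, differentiable J h) /\ differentiable (gradient J) g.

Definition hessian J g : 'M[R]_m.+1 :=
  \matrix_(i, j) partial (partial J j) i g.

Definition sym_posdef H : Prop :=
  H^T = H /\ forall v : 'rV[R]_m.+1, v != 0 -> 0 < (v *m H *m v^T) 0 0.

(* For a symmetric matrix the set of (real) eigenvalues is finite and nonempty,
   so these are its largest and smallest elements. *)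
Definition lambda_max H : R := sup [set a : R | eigenvalue H a].
Definition lambda_min H : R := inf [set a : R | eigenvalue H a].

Definition cond_number H : R := lambda_max H / lambda_min H.

End Calculus.

(* The inverse of z |-> z e^z on [0, +oo[; the default value 0 is only used for
   negative arguments. *)
Definition lambertW (R : realType) (u : R) : R :=
  xget 0 [set w : R | 0 <= w /\ w * expR w = u].

Inductive source_divergence := KL_source | chi2_source.

Section SemiDual.
Variables (R : realType) (X : ptopologicalType) (Y : topologicalType).
Variable mu : {finite_measure set (borel X) -> \bar R}.
Variables (m : nat) (y : 'I_m.+1 -> Y) (beta : 'I_m.+1 -> R).
Variables (c : X -> Y -> R) (eps rho1 rho2 : R).
Implicit Types (x : X) (g : 'rV[R]_m.+1).

Definition B_ (j : 'I_m.+1) x g : R :=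
  beta j * expR ((g 0 j - c x (y j)) / eps).

Definition Z_ x g : R := \sum_j B_ j x g.

Definition U_ x g : R := rho1 / eps * expR (rho1 / eps) * Z_ x g.

Definition J_trans (s : source_divergence) g : R :=
  match s with
  | KL_source =>
      (rho1 + eps) * \int[mu]_x (Z_ x g `^ (eps / (eps + rho1)))
  | chi2_source =>
      eps ^+ 2 / rho1 *
        \int[mu]_x (lambertW (U_ x g) + 2^-1 * lambertW (U_ x g) ^+ 2)
  end.

Definition J_semidual (s : source_divergence) g : R :=
  J_trans s g + \sum_j beta j * (g 0 j ^+ 2 / (2 * rho2) - g 0 j).

End SemiDual.

(* Main.v *)
Require Import Defs.
From HB Require Import structures.
From mathcomp Require Import all_boot all_order all_algebra.
From mathcomp Require Import all_classical all_reals all_analysis.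
From mathcomp Require Import measurable_realfun ring lra.

Set Implicit Arguments.
Unset Strict Implicit.
Unset Printing Implicit Defensive.

Import Order.TTheory GRing.Theory Num.Theory.
Import numFieldNormedType.Exports.

Local Open Scope classical_set_scope.
Local Open Scope ring_scope.

(** Put u = g - a(x), where a(x) is the row of the costs c(x, y_j), and let L
    be the logarithm of the partition function Z.  For either divergence the
    transport integrand is A(L(u)) for one scalar function A, its profile:
    (rho1 + eps) exp(alpha l) for KL, and (eps^2 / rho1) (w + w^2 / 2) with
    w = W(k exp(l)) for chi^2.  Since w' = w / (1 + w), both profiles satisfy
    0 <= A and 0 <= A''' <= A'' <= A' ([exp_profile], [lambertW_profile]), and
    the argument uses nothing else about the divergence.

    With p the Gibbs weights, the gradient of L is p / eps, so A o L has
    gradient A'(L) p / eps and Hessian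
      (A''(L) p p^T + A'(L) (diag p - p p^T)) / eps^2.
    As diag p - p p^T is a covariance matrix, this is nonnegative, and A'' <= A'
    bounds it by A'(L) diag p / eps^2, which is 1 / eps times the diagonal
    matrix of the gradient ([transport_hess_ge0], [transport_hess_le]).
    Integrating in x,
      0 <= Hess J_trans <= diag (grad J_trans) / eps,
    and the penalty adds exactly diag beta / rho2.  The lower bound gives strong
    convexity, hence uniqueness of the minimizer; it exists because the
    penalty is coercive and J_trans >= 0.  At the minimizer the first-order
    condition reads (grad J_trans)_j = beta_j (1 - g_j / rho2), which turns the
    upper bound into the diagonal matrix with entries
      beta_j / rho2 * (1 + (rho2 - g_j) / eps).
    Comparing quadratic forms on eigenvectors bounds the condition number.

    Differentiating twice under the integral sign is the technical part.  Costs
    are nonnegative, so for g in a bounded set all the arguments u = g - a(x)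
    stay in one set of the form {u : u_j <= M for all j}.  The functions
    involved are smooth functions of the weights p_j, which lie in [0, 1], and
    of A(L), A'(L), A''(L), which are bounded there because L is bounded above
    and A, A' are nondecreasing.  First-order Taylor remainders are therefore
    O(|h|^2) uniformly in x and can be integrated against the finite measure
    ([shift_int_taylor1]). *)

(** * Gradients and first-order expansions on row vectors *)

(** The library's differential is obtained by a choice operator; uniqueness of
    the linear part of an expansion identifies it with the given map. *)
Lemma is_diff_littleo (R : numFieldType) (V W : normedModType R) (f : V -> W)
    (df : {linear V -> W}) (g : V) : continuous df ->
  (forall e : R, 0 < e ->
    \forall h \near 0, `|f (g + h) - f g - df h| <= e * `|h|) ->
  is_diff g f df.
Proof.
move=> dfC H.
have E : f \o shift g = cst (f g) + df +o_ 0 id.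
  apply/eqaddoP => e e0; apply: filterS (H e e0) => h /=.
  by rewrite [g + h]addrC !fctE opprD addrA.
have D := diff_unique dfC E.
by split => //; apply/diff_locallyP; rewrite D; split.
Qed.

Section LineCalculus.
Context (R : realType) (n : nat).
Implicit Types (f : 'rV[R]_n -> R) (j : 'I_n) (u v h g : 'rV[R]_n) (c : 'I_n -> R).

Definition pairing c h : R := \sum_j h 0 j * c j.

(** Gradients are stated through directional derivatives: this form is closed
    under the one-variable rules for products and compositions, and the mean
    value theorem along segments needs nothing more. *)
Definition has_grad f (df : 'I_n -> 'rV[R]_n -> R) : Prop :=
  forall u h, is_derive u h f (pairing (df ^~ u) h).

Lemma coord_le_norm h j : `|h 0 j| <= `|h|.
Proof.
rewrite [leRHS]/Num.norm /= mx_normrE.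
by apply/bigmax_geP; right => /=; exists (ord0, j).
Qed.

Lemma norm_le_sum_coord h : `|h| <= \sum_j `|h 0 j|.
Proof.
rewrite [leLHS]/Num.norm /= mx_normrE; apply/bigmax_leP; split=> [|[i j] _ /=].
  exact: sumr_ge0.
rewrite (ord1 i) (bigD1 j)//= lerDl; exact: sumr_ge0.
Qed.

Lemma pairing_le c h C : (forall j, `|c j| <= C) -> `|pairing c h| <= n%:R * C * `|h|.
Proof.
move=> cC; apply: le_trans (ler_norm_sum _ _ _) _.
apply: (@le_trans _ _ (\sum_(j < n) C * `|h|)).
  apply: ler_sum => j _; rewrite normrM mulrC.
  by apply: ler_pM => //; exact: coord_le_norm.
by rewrite sumr_const card_ord -mulrA mulr_natl.
Qed.

Lemma pairingZ c k h : pairing c (k *: h) = k * pairing c h.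
Proof. by rewrite /pairing mulr_sumr; apply: eq_bigr => j _; rewrite mxE mulrA. Qed.

Lemma pairingD c d h :
  pairing (fun j => c j + d j) h = pairing c h + pairing d h.
Proof. by rewrite /pairing -big_split; apply: eq_bigr => j _; rewrite mulrDr. Qed.

(** Restricting to a line makes the chain rule and the mean value theorem for
    functions of one real variable available. *)
Lemma is_derive_lineP f u h d :
  is_derive u h f d <-> is_derive (0 : R) 1 (fun t : R => f (u + t *: h)) d.
Proof.
have E : (fun k : R => k^-1 *: ((f \o shift u) (k *: h) - f u)) =
  (fun k : R => k^-1 *: (((fun t : R => f (u + t *: h)) \o shift 0) (k *: 1) -
      f (u + 0 *: h))).
  by apply/funext => k /=; rewrite addr0 scale0r addr0 [k%:A]mulr1 [u + _]addrC.
split => -[D1 D2]; split.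
- by rewrite /derivable -E.
- by rewrite /derive -E.
- by rewrite /derivable E.
- by rewrite /derive E.
Qed.

Lemma is_derive_line f u h d (t : R) :
  is_derive (u + t *: h) h f d -> is_derive t 1 (fun s : R => f (u + s *: h)) d.
Proof.
move=> /is_derive_lineP [D1 D2].
have E : (fun k : R => k^-1 *:
      (((fun s : R => f (u + t *: h + s *: h)) \o shift 0) (k *: 1) -
       f (u + t *: h + 0 *: h))) =
  (fun k : R => k^-1 *: (((fun s : R => f (u + s *: h)) \o shift t) (k *: 1) -
      f (u + t *: h))).
  apply/funext => k /=; rewrite addr0 scale0r addr0 [k%:A]mulr1.
  by rewrite -addrA -scalerDl [t + k]addrC.
by split; [rewrite /derivable -E | rewrite /derive -E].
Qed.

Lemma has_grad_comp (A A1 : R -> R) f df :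
  (forall u, is_derive (f u) 1 A (A1 (f u))) -> has_grad f df ->
  has_grad (A \o f) (fun j u => A1 (f u) * df j u).
Proof.
move=> dA dfdf u h; apply/is_derive_lineP.
have /is_derive_lineP D := dfdf u h.
have E : f u = f (u + (0 : R) *: h) by rewrite scale0r addr0.
have DA : is_derive (f (u + (0 : R) *: h)) 1 A (A1 (f u)).
  by rewrite -E; exact: dA.
have := is_derive1_comp DA D.
rewrite /pairing mulr_sumr => H; apply: is_derive_eq H _.
by apply: eq_bigr => j _; rewrite mulrCA.
Qed.

Lemma has_grad_eq f df df' : (forall j u, df j u = df' j u) ->
  has_grad f df -> has_grad f df'.
Proof.
move=> E H u h; apply: is_derive_eq (H u h) _.
by apply: eq_bigr => j _; rewrite E.
Qed.

Lemma has_gradM f1 f2 df1 df2 : has_grad f1 df1 -> has_grad f2 df2 ->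
  has_grad (fun u => f1 u * f2 u) (fun j u => df1 j u * f2 u + f1 u * df2 j u).
Proof.
move=> H1 H2 u h; apply: is_derive_eq (is_deriveM (H1 u h) (H2 u h)) _.
rewrite /pairing !scaler_sumr -big_split /=; apply: eq_bigr => j _.
rewrite /GRing.scale /=; ring.
Qed.

Lemma has_gradZ (k : R) f df :
  has_grad f df -> has_grad (fun u => k * f u) (fun j u => k * df j u).
Proof.
move=> H u h; apply: is_derive_eq (is_deriveZ k (H u h)) _.
by rewrite /pairing scaler_sumr; apply: eq_bigr => j _; rewrite mulrCA.
Qed.

Lemma has_grad_sum k (f : 'I_k -> 'rV[R]_n -> R) df :
  (forall i, has_grad (f i) (df i)) ->
  has_grad (fun u => \sum_i f i u) (fun j u => \sum_i df i j u).
Proof.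
move=> H u h; have -> : (fun u => \sum_i f i u) = \sum_i f i.
  by apply/funext => v; rewrite fct_sumE.
apply: is_derive_eq (is_derive_sum (fun i => H i u h)) _.
rewrite /pairing exchange_big /=; apply: eq_bigr => j _.
by rewrite mulr_sumr.
Qed.

Lemma has_grad_mvt f df u v : has_grad f df ->
  exists2 t : R, 0 <= t <= 1 &
    f v - f u = pairing (df ^~ (u + t *: (v - u))) (v - u).
Proof.
move=> H; pose F (s : R) := f (u + s *: (v - u)).
have dF (x : R) : is_derive x 1 F (pairing (df ^~ (u + x *: (v - u))) (v - u)).
  exact/is_derive_line/H.
have [|t] := @MVT_segment R F _ 0 1 ler01 (fun x _ => dF x).
  by apply: derivable_within_continuous => x _; case: (dF x).
rewrite in_itv /= => t01; rewrite /F scale1r scale0r addr0 subr0 mulr1.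
by rewrite [u + (v - u)]addrC subrK => E; exists t.
Qed.

(** Unlike Frechet differentiability, this quadratic bound on the remainder can
    be integrated with respect to a parameter as soon as the constant is
    uniform. *)
Definition taylor1 f c g : Prop := exists C : R, forall h, `|h| <= 1 ->
  `|f (g + h) - f g - pairing c h| <= C * `|h| ^+ 2.

Lemma taylor1D f1 f2 c1 c2 g : taylor1 f1 c1 g -> taylor1 f2 c2 g ->
  taylor1 (fun u => f1 u + f2 u) (fun j => c1 j + c2 j) g.
Proof.
move=> [C1 H1] [C2 H2]; exists (C1 + C2) => h h1.
have -> : f1 (g + h) + f2 (g + h) - (f1 g + f2 g) - pairing (fun j => c1 j + c2 j) h =
  (f1 (g + h) - f1 g - pairing c1 h) + (f2 (g + h) - f2 g - pairing c2 h).
  by rewrite pairingD; ring.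
rewrite mulrDl; apply: le_trans (ler_normD _ _) _.
by apply: lerD; [exact: H1 | exact: H2].
Qed.

Lemma taylor1_diff f c g : taylor1 f c g ->
  differentiable f g /\ forall h, 'D_h f g = pairing c h.
Proof.
move=> [C H].
have lin : linear (pairing c).
  move=> a u v; rewrite /pairing scaler_sumr -big_split /=.
  by apply: eq_bigr => j _; rewrite !mxE mulrDl [a *: _]mulrA.
pose gM := GRing.isLinear.Build _ _ _ _ (pairing c) lin.
pose gL : {linear _ -> _} := HB.pack (pairing c) gM.
have gC : continuous gL.
  rewrite /gL /= /pairing.
  apply: continuous_big => [|j _ x]; first exact: add_continuous.
  by apply: continuousM; [exact: coord_continuous | exact: cst_continuous].
have [e e0|df D] := is_diff_littleo gC (f := f) (g := g); last first.
  by split => // h; rewrite deriveE // D.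
near=> h.
have h1 : `|h| <= 1.
  near: h; apply/nbhs_ballP; exists 1 => //= h.
  by rewrite -ball_normE /= sub0r normrN => /ltW.
have h2 : `|h| <= e / (`|C| + 1).
  near: h; apply/nbhs_ballP; exists (e / (`|C| + 1)) => /=.
    by rewrite divr_gt0 // ltr_wpDl.
  by move=> h; rewrite -ball_normE /= sub0r normrN => /ltW.
apply: le_trans (H h h1) _; rewrite expr2 mulrA ler_wpM2r //.
apply: le_trans (ler_wpM2r (normr_ge0 _) (ler_norm _)) _.
apply: (@le_trans _ _ ((`|C| + 1) * `|h|)).
  by rewrite ler_wpM2r // lerDl.
by rewrite -ler_pdivlMl ?ltr_wpDl // mulrC.
Unshelve. all: by end_near. Qed.

Lemma has_grad_of_taylor1 f df :
  (forall g, taylor1 f (df ^~ g) g) -> has_grad f df.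
Proof.
move=> H u h; have [fd D] := taylor1_diff (H u).
by split; [exact: diff_derivable | exact: D].
Qed.

Lemma has_grad_affine (k : R) c :
  has_grad (fun u => k + pairing c u) (fun j _ => c j).
Proof.
apply: has_grad_of_taylor1 => g; exists 0 => h _; rewrite mul0r.
have -> : pairing c (g + h) = pairing c g + pairing c h.
  by rewrite /pairing -big_split; apply: eq_bigr => j _; rewrite mxE mulrDl.
by rewrite [X in `|X|](_ : _ = 0) ?normr0 //; ring.
Qed.

(** Two applications of the mean value theorem: f (u + h) - f u is the
    derivative along h at some u + t h, and the derivative along h at u + t h
    exceeds the one at u by t times a value of the quadratic form of the
    Hessian. *)
Lemma first_order_convex f df ddf u h :
  has_grad f df -> (forall j, has_grad (df j) (ddf ^~ j)) ->
  (forall v, 0 <= pairing (fun i => pairing (fun j => ddf i j v) h) h) ->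
  f u + pairing (df ^~ u) h <= f (u + h).
Proof.
move=> fdf dfddf pos; rewrite -lerBrDl.
have [t /andP[t0 _]] := has_grad_mvt u (u + h) fdf.
rewrite [u + h - u]addrAC subrr add0r => ->.
have dF : has_grad (fun v => pairing (df ^~ v) h)
    (fun i v => pairing (fun j => ddf i j v) h).
  exact: (has_grad_sum (fun j => has_gradZ (h 0 j) (dfddf j))).
rewrite -subr_ge0.
have [s _ ->] := has_grad_mvt u (u + t *: h) dF.
rewrite [u + _ - u]addrAC subrr add0r.
by rewrite pairingZ; exact: mulr_ge0.
Qed.

End LineCalculus.

(** * Functions bounded and Lipschitz on lower orthants *)

Section Tame.
Context (R : realType) (n : nat).
Implicit Types (f : 'rV[R]_n -> R) (df : 'I_n -> 'rV[R]_n -> R).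
Implicit Types (u v h : 'rV[R]_n) (M : R).

(** Lower orthants, rather than balls, are the natural domains: translating by
    minus a nonnegative cost vector, however large, preserves them. *)
Definition below M u : Prop := forall j, u 0 j <= M.

Definition bounded_below f : Prop :=
  forall M, exists K : R, forall u, below M u -> `|f u| <= K.

Definition lipschitz_below f : Prop :=
  forall M, exists2 K : R, 0 <= K & forall u v, below M u -> below M v ->
    `|f u - f v| <= K * `|u - v|.

Definition tame f : Prop := bounded_below f /\ lipschitz_below f.

Lemma below_norm M h : `|h| <= M -> below M h.
Proof.
move=> hM j; apply: le_trans hM; exact: le_trans (ler_norm _) (coord_le_norm _ _).
Qed.

Lemma below_segment M u h (t : R) : 0 <= t <= 1 ->
  below M u -> below M (u + h) -> below M (u + t *: h).
Proof.
move=> /andP[t0 t1] uM uhM j; have := uM j; have := uhM j; rewrite !mxE => H1 H2.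
have -> : u 0 j + t * h 0 j = (1 - t) * u 0 j + t * (u 0 j + h 0 j) by ring.
have -> : M = (1 - t) * M + t * M by ring.
by apply: lerD; rewrite ler_wpM2l // subr_ge0.
Qed.

(** The bound has to be nonnegative to serve as a Lipschitz constant, hence the
    sum of absolute values instead of a maximum. *)
Lemma uniform_bound (P : 'I_n -> R -> Prop) :
  (forall j K K', K <= K' -> P j K -> P j K') -> (forall j, exists K, P j K) ->
  exists2 K : R, 0 <= K & forall j, P j K.
Proof.
move=> mono /choice[K PK]; exists (\sum_j `|K j|); first exact: sumr_ge0.
move=> j; apply: mono (PK j); apply: le_trans (ler_norm _) _.
by rewrite (bigD1 j) //= lerDl sumr_ge0.
Qed.

Lemma tame_cst (k : R) : tame (fun=> k).
Proof.
split=> M; first by exists `|k|.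
by exists 0 => // u v _ _; rewrite subrr normr0 mul0r.
Qed.

Lemma tameD f1 f2 : tame f1 -> tame f2 -> tame (fun u => f1 u + f2 u).
Proof.
move=> [b1 l1] [b2 l2]; split=> M.
  have [K1 H1] := b1 M; have [K2 H2] := b2 M; exists (K1 + K2) => u uM.
  by apply: le_trans (ler_normD _ _) _; apply: lerD; [apply: H1 | apply: H2].
have [K1 K10 H1] := l1 M; have [K2 K20 H2] := l2 M.
exists (K1 + K2) => [|u v uM vM]; first exact: addr_ge0.
have -> : f1 u + f2 u - (f1 v + f2 v) = (f1 u - f1 v) + (f2 u - f2 v) by ring.
apply: le_trans (ler_normD _ _) _; rewrite mulrDl.
by apply: lerD; [apply: H1 | apply: H2].
Qed.

Lemma tameM f1 f2 : tame f1 -> tame f2 -> tame (fun u => f1 u * f2 u).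
Proof.
move=> [b1 l1] [b2 l2]; split=> M.
  have [K1 H1] := b1 M; have [K2 H2] := b2 M; exists (K1 * K2) => u uM.
  by rewrite normrM; apply: ler_pM => //; [apply: H1 | apply: H2].
have [B1 bH1] := b1 M; have [B2 bH2] := b2 M.
have [K1 K10 H1] := l1 M; have [K2 K20 H2] := l2 M.
exists (`|B1| * K2 + `|B2| * K1) => [|u v uM vM].
  by apply: addr_ge0; apply: mulr_ge0.
have -> : f1 u * f2 u - f1 v * f2 v =
  f1 u * (f2 u - f2 v) + f2 v * (f1 u - f1 v) by ring.
apply: le_trans (ler_normD _ _) _; rewrite mulrDl !normrM -!mulrA.
apply: lerD; apply: ler_pM => //; [|exact: H2| |exact: H1].
  exact: le_trans (bH1 _ uM) (ler_norm _).
exact: le_trans (bH2 _ vM) (ler_norm _).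
Qed.

Lemma tame_sum (I : finType) (f : I -> 'rV[R]_n -> R) : (forall i, tame (f i)) ->
  tame (fun u => \sum_i f i u).
Proof.
move=> tf; suff H (s : seq I) : tame (fun u => \sum_(i <- s) f i u) by exact: H.
elim: s => [|i s IH]; first by under eq_fun do rewrite big_nil; exact: tame_cst.
by under eq_fun do rewrite big_cons; exact: tameD.
Qed.

Lemma tame_pairing df h : (forall j, tame (df j)) ->
  tame (fun u => pairing (df ^~ u) h).
Proof.
by move=> tdf; apply: tame_sum => j; apply: tameM => //; exact: tame_cst.
Qed.

(** The lower orthant is convex, so the mean value theorem on a segment never
    leaves the region where the gradient is controlled. *)
Lemma tame_of_grad f df : has_grad f df -> bounded_below f ->
  (forall j, bounded_below (df j)) -> tame f.
Proof.
move=> fdf bf bdf; split => // M.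
have [K K0 HK] : exists2 K : R, 0 <= K &
    forall j u, below M u -> `|df j u| <= K.
  apply: (uniform_bound (P := fun j K => forall u, below M u -> `|df j u| <= K)).
    by move=> j K K' KK' H u uM; exact: le_trans (H u uM) KK'.
  by move=> j; have [K H] := bdf j M; exists K.
exists (n%:R * K) => [|u v uM vM]; first exact: mulr_ge0.
have [t t01 ->] := has_grad_mvt v u fdf.
apply: pairing_le => j; apply: HK; apply: below_segment => //.
by rewrite addrC subrK.
Qed.

(** By the mean value theorem the remainder is the variation of the gradient
    between u and some u + t h, paired with h; one factor |h| comes from the
    Lipschitz bound and one from the pairing.  The constant depends on the
    orthant only. *)
Lemma taylor_below f df M : has_grad f df -> (forall j, tame (df j)) ->
  exists C : R, forall u h, below M u -> below M (u + h) ->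
    `|f (u + h) - f u - pairing (df ^~ u) h| <= C * `|h| ^+ 2.
Proof.
move=> fdf tdf.
have [K K0 HK] : exists2 K : R, 0 <= K & forall j u v, below M u -> below M v ->
    `|df j u - df j v| <= K * `|u - v|.
  apply: (uniform_bound (P := fun j K => forall u v, below M u -> below M v ->
    `|df j u - df j v| <= K * `|u - v|)).
    move=> j K K' KK' H u v uM vM; apply: le_trans (H u v uM vM) _.
    by rewrite ler_wpM2r.
  by move=> j; have [_ /(_ M)[K _ H]] := tdf j; exists K.
exists (n%:R * K) => u h uM uhM.
have [t t01] := has_grad_mvt u (u + h) fdf.
rewrite [u + h - u]addrAC subrr add0r => ->.
have -> : pairing (df ^~ (u + t *: h)) h - pairing (df ^~ u) h =
    pairing (fun j => df j (u + t *: h) - df j u) h.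
  by rewrite /pairing -sumrB; apply: eq_bigr => j _; rewrite mulrBr.
have -> : n%:R * K * `|h| ^+ 2 = n%:R * (K * `|h|) * `|h| by ring.
apply: pairing_le => j; apply: le_trans (HK _ _ _ (below_segment t01 uM uhM) uM) _.
rewrite [u + _ - u]addrAC subrr add0r normrZ mulrA.
case/andP: t01 => t0 t1; rewrite ger0_norm // ler_wpM2r // ler_piMr //.
Qed.

End Tame.

(** * Integrals of translates by a nonnegative row *)

Section ShiftedIntegral.
Context (R : realType) (X : ptopologicalType).
Variable mu : {finite_measure set (borel X) -> \bar R}.
Context (n : nat) (a : X -> 'rV[R]_n).
Hypothesis a_ge0 : forall x j, 0 <= a x 0 j.
Hypothesis a_cont : forall j, continuous (fun x => a x 0 j).
Implicit Types (f : 'rV[R]_n -> R) (df : 'I_n -> 'rV[R]_n -> R).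
Implicit Types (u v h g : 'rV[R]_n) (M : R).

(** The transport part of the objective and all its partial derivatives have
    this form, where a x is the row of costs at the point x. *)
Definition shift_int f g : R := \int[mu]_x f (g - a x).

Lemma continuous_borel_measurable (phi : X -> R) :
  continuous phi -> measurable_fun setT (phi : borel X -> R).
Proof.
move=> /continuousP cphi.
apply: (measurability _ (RGenOpens.measurableE R)) => _ [_ [r [s ->] <-]].
rewrite setTI; apply: sub_sigma_algebra; apply: cphi; exact: interval_open.
Qed.

Lemma below_shift M g x : below M g -> below M (g - a x).
Proof.
by move=> gM j; rewrite !mxE; apply: le_trans (gM j); rewrite lerBlDr lerDl.
Qed.

(** Borel measurability of the integrands comes from continuity in x: the
    Lipschitz bound holds on the whole orthant containing all the g - a x. *)
Lemma continuous_shift f g : tame f -> continuous (fun x => f (g - a x)).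
Proof.
move=> [_ lf]. have gM : below `|g| g by exact: below_norm.
have [K K0 HK] := lf `|g| => x; apply/cvgrPdist_le => /= e e0; near=> z.
have := HK _ _ (below_shift x gM) (below_shift z gM); move=> /le_trans; apply.
have -> : g - a x - (g - a z) = a z - a x by rewrite opprB addrC addrA subrK.
apply: le_trans (ler_wpM2l K0 (norm_le_sum_coord _)) _.
have : \sum_j `|(a z - a x) 0 j| <= e / (K + 1).
  near: z.
  have : (\sum_j `|(a z - a x) 0 j|) @[z --> x] --> (\sum_j `|(a x - a x) 0 j|).
    apply: cvg_big => [|j _]; first exact: add_continuous.
    under eq_fun do rewrite !mxE.
    by rewrite !mxE; apply: cvg_norm; apply: cvgB; [exact: a_cont|exact: cvg_cst].
  rewrite big1 => [|j _]; last by rewrite !mxE subrr normr0.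
  move=> /cvgrPdist_le /(_ (e / (K + 1))) /= H.
  have : 0 < e / (K + 1) by rewrite divr_gt0 // ltr_wpDl.
  move=> /H; apply: filterS => z; rewrite sub0r normrN ger0_norm //.
  exact: sumr_ge0.
move=> H; apply: le_trans (ler_wpM2l K0 H) _.
by rewrite mulrCA ger_pMr // ler_pdivrMr ?ltr_wpDl // mul1r lerDl.
Unshelve. all: by end_near. Qed.

Lemma shift_integrable f g : tame f ->
  mu.-integrable setT (EFin \o (fun x : borel X => f (g - a x))).
Proof.
move=> tf; apply: measurable_bounded_integrable => //.
- exact: fin_num_fun_lty.
- apply: (@continuous_borel_measurable (fun x => f (g - a x))).
  exact: continuous_shift.
have [/(_ `|g|)[K HK] _] := tf.
exists K; split; first exact: num_real.
move=> K' KK' x _ /=; apply: le_trans (ltW KK').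
by apply/HK/below_shift/below_norm.
Qed.

Lemma shift_intD f1 f2 g : tame f1 -> tame f2 ->
  shift_int (fun u => f1 u + f2 u) g = shift_int f1 g + shift_int f2 g.
Proof. by move=> t1 t2; rewrite /shift_int RintegralD//; exact: shift_integrable. Qed.

Lemma shift_intZ (k : R) f g : tame f ->
  shift_int (fun u => k * f u) g = k * shift_int f g.
Proof. by move=> t; rewrite /shift_int RintegralZl//; exact: shift_integrable. Qed.

Lemma shift_int_le f1 f2 g1 g2 : tame f1 -> tame f2 ->
  (forall x, f1 (g1 - a x) <= f2 (g2 - a x)) -> shift_int f1 g1 <= shift_int f2 g2.
Proof.
by move=> t1 t2 H; apply: le_Rintegral => //; exact: shift_integrable.
Qed.

Lemma shift_int_sum (I : finType) (f : I -> 'rV[R]_n -> R) g :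
  (forall i, tame (f i)) ->
  shift_int (fun u => \sum_i f i u) g = \sum_i shift_int (f i) g.
Proof.
move=> tf.
suff H (s : seq I) : tame (fun u => \sum_(i <- s) f i u) /\
  shift_int (fun u => \sum_(i <- s) f i u) g = \sum_(i <- s) shift_int (f i) g.
  by have [] := H (index_enum I).
elim: s => [|i s [IH1 IH2]].
  under eq_fun do rewrite big_nil; split; first exact: tame_cst.
  by rewrite big_nil /shift_int Rintegral_cst // mul0r.
under eq_fun do rewrite big_cons; split; first exact: tameD.
by rewrite shift_intD // IH2 big_cons.
Qed.

Lemma pairing_shift_int df g h : (forall j, tame (df j)) ->
  pairing (fun j => shift_int (df j) g) h =
  shift_int (fun u => pairing (df ^~ u) h) g.
Proof.
move=> tdf; rewrite /pairing shift_int_sum => [|j].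
  by apply: eq_bigr => j _; rewrite shift_intZ.
by apply: tameM => //; exact: tame_cst.
Qed.

End ShiftedIntegral.

(** * Differentiation under the integral sign *)

Section DifferentiationUnderIntegral.
Context (R : realType) (X : ptopologicalType).
Variable mu : {finite_measure set (borel X) -> \bar R}.
Context (n : nat) (a : X -> 'rV[R]_n).
Hypothesis a_ge0 : forall x j, 0 <= a x 0 j.
Hypothesis a_cont : forall j, continuous (fun x => a x 0 j).
Implicit Types (f : 'rV[R]_n -> R) (df : 'I_n -> 'rV[R]_n -> R).

(** For |h| <= 1 all the points g - a x and g + h - a x lie in the orthant of
    level |g| + 1, so the remainders of the integrand are bounded by one
    constant times |h|^2, and the total mass of [mu] is finite. *)
Lemma shift_int_taylor1 f df g :
  has_grad f df -> tame f -> (forall j, tame (df j)) ->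
  taylor1 (shift_int mu a f) (fun j => shift_int mu a (df j) g) g.
Proof.
move=> fdf tf tdf; have [C HC] := taylor_below (`|g| + 1) fdf tdf.
exists (C * fine (mu setT)) => h h1.
pose r (x : borel X) :=
  f (g + h - a x) - f (g - a x) - pairing (df ^~ (g - a x)) h.
have i1 : mu.-integrable setT (EFin \o (fun x : borel X => f (g + h - a x))).
  exact: shift_integrable.
have i2 : mu.-integrable setT (EFin \o (fun x : borel X => f (g - a x))).
  exact: shift_integrable.
have i3 : mu.-integrable setT
    (EFin \o (fun x : borel X => pairing (df ^~ (g - a x)) h)).
  exact: (shift_integrable mu a_ge0 a_cont g (tame_pairing h tdf)).
have i12 := integrableB measurableT i1 i2.
have ir := integrableB measurableT i12 i3.
have -> : shift_int mu a f (g + h) - shift_int mu a f g -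
    pairing (fun j => shift_int mu a (df j) g) h = \int[mu]_x r x.
  by rewrite pairing_shift_int // /shift_int /r !RintegralB.
have rC (x : X) : `|r x| <= C * `|h| ^+ 2.
  rewrite /r; have -> : g + h - a x = g - a x + h by rewrite addrAC.
  apply: HC.
    by apply: below_shift => //; apply: below_norm; rewrite lerDl.
  rewrite addrAC; apply: below_shift => //; apply: below_norm.
  by apply: le_trans (ler_normD _ _) _; rewrite lerD2l.
apply: le_trans (le_normr_Rintegral _ _) _ => //.
have -> : C * fine (mu setT) * `|h| ^+ 2 = \int[mu]_(x in setT) (C * `|h| ^+ 2).
  by rewrite Rintegral_cst // mulrAC.
apply: le_Rintegral => //; first exact: (integrable_norm ir).
by apply: finite_measure_integrable_cst.
Qed.

End DifferentiationUnderIntegral.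

(** * Profiles composed with the log-sum-exp function *)

Lemma nondecreasing_of_derive (R : realType) (f f1 : R -> R) :
  (forall l : R, is_derive l 1 f (f1 l)) -> (forall l, 0 <= f1 l) ->
  {homo f : x y / x <= y}.
Proof.
move=> df f1_ge0 x y xy; rewrite -subr_ge0.
have [|c _ ->] := MVT_segment xy (fun x _ => df x); last first.
  by rewrite mulr_ge0 // subr_ge0.
by apply: derivable_within_continuous => z _; case: (df z).
Qed.

(** The common shape of the two source divergences, as functions of the
    logarithm l of the partition function.  The inequality A2 <= A1 gives the
    upper bound on the Hessian; A3 is there to make A2 Lipschitz on half-lines,
    which yields differentiability of the second derivatives under the
    integral. *)
Record profile (R : realType) (A A1 A2 A3 : R -> R) : Prop := Profile {
  profile_d1 : forall l : R, is_derive l 1 A (A1 l);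
  profile_d2 : forall l : R, is_derive l 1 A1 (A2 l);
  profile_d3 : forall l : R, is_derive l 1 A2 (A3 l);
  profile_ge0 : forall l, 0 <= A l;
  profile3_ge0 : forall l, 0 <= A3 l;
  profile32 : forall l, A3 l <= A2 l;
  profile21 : forall l, A2 l <= A1 l }.

Section LogSumExp.
Context (R : realType) (m : nat) (beta : 'I_m.+1 -> R) (eps : R).
Hypothesis beta_gt0 : forall j, 0 < beta j.
Hypothesis eps_gt0 : 0 < eps.
Implicit Types (u v h : 'rV[R]_m.+1) (i j : 'I_m.+1).

Definition partition_fun u : R := \sum_j beta j * expR (u 0 j / eps).
Definition lse u : R := ln (partition_fun u).
Definition gibbs j u : R := beta j * expR (u 0 j / eps) / partition_fun u.

Lemma partition_fun_gt0 u : 0 < partition_fun u.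
Proof.
rewrite /partition_fun big_ord_recl ltr_pwDl //; first by rewrite mulr_gt0 ?expR_gt0.
by apply: sumr_ge0 => j _; rewrite mulr_ge0 ?expR_ge0 // ltW.
Qed.

Lemma gibbs_ge0 j u : 0 <= gibbs j u.
Proof.
by rewrite divr_ge0 ?mulr_ge0 ?expR_ge0 // ltW // partition_fun_gt0.
Qed.

Lemma sum_gibbs u : \sum_j gibbs j u = 1.
Proof. by rewrite -mulr_suml divff // gt_eqF // partition_fun_gt0. Qed.

Lemma gibbs_le1 j u : gibbs j u <= 1.
Proof.
rewrite -(sum_gibbs u) (bigD1 j) //= lerDl.
by apply: sumr_ge0 => i _; exact: gibbs_ge0.
Qed.

Lemma coord_pairing j u : u 0 j / eps = 0 + pairing (fun i => (i == j)%:R / eps) u.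
Proof.
rewrite add0r /pairing (bigD1 j) //= eqxx big1 => [|i /negPf ->].
  by rewrite addr0 mul1r.
by rewrite mul0r mulr0.
Qed.

Lemma has_grad_coord j :
  has_grad (fun u => u 0 j / eps) (fun i _ => (i == j)%:R / eps).
Proof.
have -> : (fun u => u 0 j / eps) =
    (fun u => 0 + pairing (fun i => (i == j)%:R / eps) u).
  by apply/funext => u; rewrite coord_pairing.
exact: has_grad_affine.
Qed.

Lemma has_grad_partition_fun :
  has_grad partition_fun (fun i u => beta i * expR (u 0 i / eps) / eps).
Proof.
have H j : has_grad (fun u => beta j * expR (u 0 j / eps))
    (fun i u => beta j * (expR (u 0 j / eps) * ((i == j)%:R / eps))).
  apply: has_gradZ; apply: (has_grad_comp (A := @expR R)).
  exact: has_grad_coord.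
apply: has_grad_eq (has_grad_sum H) => i u /=.
rewrite (bigD1 i) //= eqxx big1 => [|j]; first by rewrite addr0 mul1r mulrA.
by rewrite eq_sym => /negPf ->; rewrite mul0r !mulr0.
Qed.

Lemma has_grad_lse : has_grad lse (fun i u => gibbs i u / eps).
Proof.
have H := has_grad_comp (A := @ln R) (A1 := fun x : R => x^-1)
  (fun u => is_derive1_ln (partition_fun_gt0 u)) has_grad_partition_fun.
apply: has_grad_eq H => i u /=.
by rewrite /gibbs mulrC mulrAC.
Qed.

(** In this form the derivative of a weight comes from the chain rule alone. *)
Lemma gibbsE j u : gibbs j u = beta j * expR (u 0 j / eps - lse u).
Proof. by rewrite expRD expRN lnK ?posrE ?partition_fun_gt0 // mulrA. Qed.

Lemma has_grad_gibbs j :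
  has_grad (gibbs j) (fun i u => gibbs j u * (((i == j)%:R - gibbs i u) / eps)).
Proof.
have -> : gibbs j = (fun u => beta j * expR (u 0 j / eps - lse u)).
  by apply/funext => u; exact: gibbsE.
have H1 : has_grad (fun u => u 0 j / eps - lse u)
    (fun i u => ((i == j)%:R - gibbs i u) / eps).
  move=> u h; have := is_deriveB (has_grad_coord j u h) (has_grad_lse u h).
  move=> H; apply: is_derive_eq H _; rewrite /pairing -sumrB.
  by apply: eq_bigr => i _; rewrite mulrBl mulrBr.
have H2 := has_gradZ (beta j) (has_grad_comp (fun u => is_derive_expR _) H1).
by apply: has_grad_eq H2 => i u /=; rewrite mulrA.
Qed.

Lemma lse_below M u : below M u -> lse u <= ln (\sum_j beta j * expR (M / eps)).
Proof.
move=> uM; rewrite ler_ln ?posrE ?partition_fun_gt0 //; last first.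
  by have := partition_fun_gt0 (const_mx M); rewrite /partition_fun;
    under eq_bigr do rewrite mxE.
apply: ler_sum => j _; rewrite ler_wpM2l ?ler_expR ?ler_wpM2r ?invr_ge0 //; exact: ltW.
Qed.

(** Both the weights and their logarithmic derivatives are bounded on the whole
    space. *)
Lemma tame_gibbs j : tame (gibbs j).
Proof.
have b : bounded_below (gibbs j).
  by move=> M; exists 1 => u _; rewrite ger0_norm ?gibbs_le1 ?gibbs_ge0.
apply: tame_of_grad (has_grad_gibbs j) b _ => i M; exists (2 / eps) => u _.
rewrite normrM [X in _ * X]normrM [`|eps^-1|]ger0_norm ?invr_ge0 ?(ltW eps_gt0) //.
rewrite mulrA; apply: ler_wpM2r; first by rewrite invr_ge0 ltW.
rewrite -[2]mul1r; apply: ler_pM => //.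
  by rewrite ger0_norm ?gibbs_le1 ?gibbs_ge0.
apply: le_trans (ler_normB _ _) _; rewrite -[2]/(1 + 1); apply: lerD.
  by case: eqP; rewrite ?normr1 ?normr0.
by rewrite ger0_norm ?gibbs_le1 ?gibbs_ge0.
Qed.

Section Profile.
Context (A A1 A2 A3 : R -> R).
Hypothesis prof : profile A A1 A2 A3.

Let A2_ge0 l : 0 <= A2 l.
Proof. exact: le_trans (profile3_ge0 prof l) (profile32 prof l). Qed.

Let A1_ge0 l : 0 <= A1 l.
Proof. exact: le_trans (A2_ge0 l) (profile21 prof l). Qed.

(** On a lower orthant [lse] is bounded above, but not below: an upper bound of
    [f] on each half-line to the left is exactly what is required. *)
Lemma bounded_below_lse (f : R -> R) :
  (forall l, 0 <= f l) -> (forall M, exists K, forall l, l <= M -> f l <= K) ->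
  bounded_below (f \o lse).
Proof.
move=> f0 fb M; have [K HK] := fb (ln (\sum_j beta j * expR (M / eps))).
by exists K => u /lse_below /HK; rewrite ger0_norm /=.
Qed.

Lemma profile_bounded_below :
  [/\ bounded_below (A \o lse), bounded_below (A1 \o lse),
      bounded_below (A2 \o lse) & bounded_below (A3 \o lse)].
Proof.
have A1_mono := nondecreasing_of_derive (profile_d2 prof) A2_ge0.
split; apply: bounded_below_lse => //.
- exact: profile_ge0 prof.
- move=> M; exists (A M) => l.
  exact: (nondecreasing_of_derive (profile_d1 prof) A1_ge0).
- by move=> M; exists (A1 M) => l lM; exact: A1_mono.
- move=> M; exists (A1 M) => l lM; apply: le_trans (profile21 prof l) _.
  exact: A1_mono.
- exact: profile3_ge0 prof.
- move=> M; exists (A1 M) => l lM; apply: le_trans (profile32 prof l) _.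
  by apply: le_trans (profile21 prof l) _; exact: A1_mono.
Qed.

Lemma bounded_below_gibbs (f : R -> R) j : bounded_below (f \o lse) ->
  bounded_below (fun u => f (lse u) * (gibbs j u / eps)).
Proof.
move=> fb M; have [K HK] := fb M; exists (K * (1 / eps)) => u uM.
rewrite normrM; apply: ler_pM => //; first exact: HK.
have e0 : 0 <= eps^-1 by rewrite invr_ge0 ltW.
rewrite ger0_norm; last by apply: mulr_ge0 => //; exact: gibbs_ge0.
by rewrite ler_wpM2r ?gibbs_le1.
Qed.

Definition transport u : R := A (lse u).
Definition transport_grad j u : R := A1 (lse u) * (gibbs j u / eps).
(** The product rule applied to [transport_grad j], kept in the form that it
    produces; [transport_hess_quadratic] gives its symmetric meaning. *)
Definition transport_hess i j u : R :=
  A2 (lse u) * (gibbs i u / eps) * (gibbs j u / eps) +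
  A1 (lse u) * (gibbs j u * (((i == j)%:R - gibbs i u) / eps) / eps).

Lemma has_grad_transport : has_grad transport transport_grad.
Proof. exact: has_grad_comp (fun u => profile_d1 prof _) has_grad_lse. Qed.

Lemma has_grad_transport_grad j : has_grad (transport_grad j) (transport_hess ^~ j).
Proof.
have H := has_gradM (has_grad_comp (fun u => profile_d2 prof _) has_grad_lse)
  (has_gradZ eps^-1 (has_grad_gibbs j)).
have -> : transport_grad j = (fun u => (A1 \o lse) u * (eps^-1 * gibbs j u)).
  by apply/funext => u; rewrite /transport_grad [_ / eps]mulrC.
apply: has_grad_eq H => i u /=.
by rewrite /transport_hess; ring.
Qed.

Lemma tame_transport : tame transport.
Proof.
have [b0 b1 _ _] := profile_bounded_below.
by apply: tame_of_grad has_grad_transport b0 _ => j; exact: bounded_below_gibbs.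
Qed.

Lemma tame_A1_lse : tame (A1 \o lse).
Proof.
have [_ b1 b2 _] := profile_bounded_below.
apply: tame_of_grad (has_grad_comp (fun u => profile_d2 prof _) has_grad_lse) b1 _.
by move=> j; exact: bounded_below_gibbs.
Qed.

Lemma tame_A2_lse : tame (A2 \o lse).
Proof.
have [_ _ b2 b3] := profile_bounded_below.
apply: tame_of_grad (has_grad_comp (fun u => profile_d3 prof _) has_grad_lse) b2 _.
by move=> j; exact: bounded_below_gibbs.
Qed.

Lemma tame_transport_grad j : tame (transport_grad j).
Proof.
apply: tameM tame_A1_lse _; apply: tameM (tame_gibbs j) (tame_cst _ _).
Qed.

Lemma tame_transport_hess i j : tame (transport_hess i j).
Proof.
have tg k : tame (fun u => gibbs k u / eps).
  exact: tameM (tame_gibbs k) (tame_cst _ _).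
apply: tameD; first exact: tameM (tameM tame_A2_lse (tg i)) (tg j).
apply: tameM tame_A1_lse _; apply: tameM (tame_cst _ _).
apply: tameM (tame_gibbs j) _; apply: tameM (tame_cst _ _).
apply: tameD (tame_cst _ _) _.
have -> : (fun u => - gibbs i u) = (fun u => -1 * gibbs i u).
  by apply/funext => u; rewrite mulN1r.
exact: tameM (tame_cst _ _) (tame_gibbs i).
Qed.

Lemma transport_hess_sym i j u : transport_hess i j u = transport_hess j i u.
Proof.
by rewrite /transport_hess eq_sym; case: (eqVneq j i) => [->|_] //=; ring.
Qed.

(** The two brackets are the square of the mean of v and the variance of v
    under the Gibbs weights. *)
Lemma transport_hess_quadratic u v :
  pairing (fun i => pairing (fun j => transport_hess i j u) v) v =
  (A2 (lse u) * (\sum_j gibbs j u * v 0 j) ^+ 2 +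
   A1 (lse u) * (\sum_j gibbs j u * v 0 j ^+ 2 -
                 (\sum_j gibbs j u * v 0 j) ^+ 2)) / eps ^+ 2.
Proof.
set S := \sum_j gibbs j u * v 0 j; set Q := \sum_j gibbs j u * v 0 j ^+ 2.
have inner i : pairing (fun j => transport_hess i j u) v =
    ((A2 (lse u) - A1 (lse u)) * gibbs i u * S +
     A1 (lse u) * (gibbs i u * v 0 i)) / eps ^+ 2.
  rewrite /pairing mulrDl mulr_sumr mulr_suml.
  rewrite -[X in _ + X](_ : \sum_j A1 (lse u) *
    (gibbs j u * (i == j)%:R * v 0 j) / eps ^+ 2 = _); last first.
    rewrite (bigD1 i) //= eqxx big1 ?addr0 ?mulr1 // => j.
    by rewrite eq_sym => /negPf ->; rewrite !(mulr0, mul0r).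
  rewrite -big_split /=; apply: eq_bigr => j _.
  rewrite /transport_hess; field; exact: lt0r_neq0.
rewrite {1}/pairing; under eq_bigr do rewrite inner.
have SE : S = \sum_j gibbs j u * v 0 j by []; clearbody S.
transitivity (((A2 (lse u) - A1 (lse u)) * S * (\sum_j gibbs j u * v 0 j) +
    A1 (lse u) * (\sum_j gibbs j u * v 0 j ^+ 2)) / eps ^+ 2).
  rewrite mulrDl !mulr_sumr !mulr_suml -big_split /=.
  by apply: eq_bigr => j _; ring.
by rewrite -SE -/Q; ring.
Qed.

(** The difference is the variance, a sum of squares centred at the mean. *)
Lemma gibbs_variance u v :
  (\sum_j gibbs j u * v 0 j) ^+ 2 <= \sum_j gibbs j u * v 0 j ^+ 2.
Proof.
set S := \sum_j gibbs j u * v 0 j; rewrite -subr_ge0.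
have SE : S = \sum_j gibbs j u * v 0 j by []; clearbody S.
have -> : \sum_j gibbs j u * v 0 j ^+ 2 - S ^+ 2 =
    \sum_j gibbs j u * (v 0 j - S) ^+ 2.
  transitivity (\sum_j gibbs j u * v 0 j ^+ 2 +
      (- 2 * S * (\sum_j gibbs j u * v 0 j) + S ^+ 2 * \sum_j gibbs j u)).
    by rewrite sum_gibbs -SE; ring.
  rewrite !mulr_sumr -!big_split /=; apply: eq_bigr => j _; ring.
by apply: sumr_ge0 => j _; apply: mulr_ge0; [exact: gibbs_ge0 | exact: sqr_ge0].
Qed.

Lemma transport_hess_ge0 u v :
  0 <= pairing (fun i => pairing (fun j => transport_hess i j u) v) v.
Proof.
rewrite transport_hess_quadratic divr_ge0 ?sqr_ge0 // addr_ge0 // mulr_ge0 ?sqr_ge0 //.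
by rewrite subr_ge0 gibbs_variance.
Qed.

(** The mean squared carries the coefficient A2 - A1 <= 0, so dropping it leaves
    A1 times the second moment, which is the gradient paired with the squares
    of v, up to a factor eps. *)
Lemma transport_hess_le u v :
  pairing (fun i => pairing (fun j => transport_hess i j u) v) v <=
  (\sum_j transport_grad j u * v 0 j ^+ 2) / eps.
Proof.
rewrite transport_hess_quadratic; set S := \sum_j gibbs j u * v 0 j.
have -> : (\sum_j transport_grad j u * v 0 j ^+ 2) / eps =
    A1 (lse u) * (\sum_j gibbs j u * v 0 j ^+ 2) / eps ^+ 2.
  rewrite mulr_sumr !mulr_suml; apply: eq_bigr => j _; rewrite /transport_grad.
  by field; exact: lt0r_neq0.
rewrite ler_wpM2r ?invr_ge0 ?sqr_ge0 //.
rewrite mulrBr addrA addrAC -mulrBl addrC -lerBrDl subrr.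
by rewrite mulr_le0_ge0 ?sqr_ge0 // subr_le0 (profile21 prof).
Qed.

Lemma transport_grad_ge0 j u : 0 <= transport_grad j u.
Proof. apply: mulr_ge0 => //; apply: divr_ge0; [exact: gibbs_ge0 | exact: ltW]. Qed.

End Profile.
End LogSumExp.

(** * The exponential and Lambert profiles *)

Lemma profileZ (R : realType) (k : R) (A A1 A2 A3 : R -> R) : 0 <= k ->
  profile A A1 A2 A3 ->
  profile (fun l => k * A l) (fun l => k * A1 l) (fun l => k * A2 l)
          (fun l => k * A3 l).
Proof.
move=> k0 [d1 d2 d3 A0 A30 A32 A21]; split => l; rewrite ?ler_wpM2l ?mulr_ge0 //.
- exact: (is_deriveZ k (d1 l)).
- exact: (is_deriveZ k (d2 l)).
- exact: (is_deriveZ k (d3 l)).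
Qed.

Lemma exp_profile (R : realType) (alpha : R) : 0 <= alpha <= 1 ->
  profile (fun l => expR (alpha * l))
          (fun l => alpha * expR (alpha * l))
          (fun l => alpha ^+ 2 * expR (alpha * l))
          (fun l => alpha ^+ 3 * expR (alpha * l)).
Proof.
move=> /andP[a0 a1].
have d (l : R) : is_derive l 1 (fun l => expR (alpha * l))
    (alpha * expR (alpha * l)).
  have D : is_derive l 1 (fun l => alpha * l) alpha.
    by apply: is_derive_eq (is_deriveZ alpha (is_derive_id l 1)) _;
      rewrite [_ *: _]mulr1.
  apply: is_derive_eq (is_derive1_comp (is_derive_expR (alpha * l)) D) _.
  exact: mulrC.
split => l.
- exact: d.
- by apply: is_derive_eq (is_deriveZ alpha (d l)) _; rewrite expr2 -mulrA.
- by apply: is_derive_eq (is_deriveZ (alpha ^+ 2) (d l)) _;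
    rewrite [_ ^+ 3]exprSr -mulrA.
- exact: expR_ge0.
- by rewrite mulr_ge0 ?expR_ge0 ?exprn_ge0.
- by rewrite ler_wpM2r ?expR_ge0 // [_ ^+ 3]exprSr ler_piMr ?exprn_ge0.
- by rewrite ler_wpM2r ?expR_ge0 // expr2 ler_piMr.
Qed.

Section Lambert.
Context (R : realType).
Implicit Types (u v w l k c : R).

Lemma xexp_mono v w : 0 <= v -> v < w -> v * expR v < w * expR w.
Proof.
move=> v0 vw; apply: (@le_lt_trans _ _ (v * expR w)).
  by rewrite ler_wpM2l // ler_expR ltW.
by rewrite ltr_pM2r // expR_gt0.
Qed.

Lemma xexp_inj v w : 0 <= v -> 0 <= w -> v * expR v = w * expR w -> v = w.
Proof.
move=> v0 w0 E; case: (ltgtP v w) => // [/(xexp_mono v0)|/(xexp_mono w0)];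
  by rewrite E ltxx.
Qed.

(** Existence is the intermediate value theorem on [0, u], where
    u <= u exp u. *)
Lemma lambertW_spec u : 0 <= u -> 0 <= lambertW u /\ lambertW u * expR (lambertW u) = u.
Proof.
move=> u0; pose f (w : R) := w * expR w.
have fc : {within `[0, u], continuous f}.
  apply: derivable_within_continuous => x _.
  by apply: derivableM; [exact: derivable_id | exact: derivable_expR].
have fu : Num.min (f 0) (f u) <= u <= Num.max (f 0) (f u).
  rewrite /f mul0r ge_min u0 /= le_max; apply/orP; right.
  by rewrite ler_peMr // -expR0 ler_expR.
have [w] := IVT u0 fc fu.
rewrite in_itv /= => /andP[w0 _] fw.
exact: (@xgetPex _ 0 [set w : R | 0 <= w /\ w * expR w = u]
  (ex_intro _ w (conj w0 fw))).
Qed.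

Lemma lambertW_xexp w : 0 <= w -> lambertW (w * expR w) = w.
Proof.
move=> w0.
have [|W0 WE] := @lambertW_spec (w * expR w); first by rewrite mulr_ge0 ?expR_ge0.
exact: xexp_inj W0 w0 WE.
Qed.

Lemma lambertW_gt0 u : 0 < u -> 0 < lambertW u.
Proof.
move=> u0; have [W0 WE] := lambertW_spec (ltW u0).
by rewrite lt_neqAle W0 andbT; apply: contra_ltN u0 => /eqP E; rewrite -WE -E mul0r.
Qed.

(** As a function of l, w = W (k exp l) is the inverse of
    x |-> ln x + x - ln k on the positive axis, whose derivative 1 / x + 1 is
    explicit. *)
Lemma is_derive_lambertW_exp k l : 0 < k ->
  is_derive l 1 (fun l => lambertW (k * expR l))
    (lambertW (k * expR l) / (1 + lambertW (k * expR l))).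
Proof.
move=> k0; set w := lambertW (k * expR l).
have kl0 : 0 < k * expR l by rewrite mulr_gt0 ?expR_gt0.
have w0 : 0 < w by exact: lambertW_gt0.
have [_ wE] := lambertW_spec (ltW kl0); rewrite -/w in wE.
pose f (x : R) := ln x + x - ln k.
have fw : f w = l.
  have E : ln w + w = ln (w * expR w) by rewrite lnM ?posrE ?expR_gt0 // expRK.
  by rewrite /f E wE lnM ?posrE ?expR_gt0 // expRK addrC addKr.
have fK (x : R) : 0 < x -> lambertW (k * expR (f x)) = x.
  move=> x0; rewrite /f expRD expRN expRD !lnK ?posrE //.
  by rewrite mulrCA divff ?gt_eqF // mulr1 lambertW_xexp // ltW.
have df (x : R) : 0 < x -> is_derive x 1 f (x^-1 + 1).
  move=> x0; have D1 := is_derive1_ln x0.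
  have D := is_deriveD D1 (is_derive_id x 1).
  apply: is_derive_eq (is_deriveB D (is_derive_cst (ln k) x 1)) _.
  by rewrite subr0.
have near_pos : \forall x \near w, (0 : R) < x by exact: lt_nbhsr.
rewrite -fw.
(* The derivative in the shape produced by the inverse function rule. *)
have -> : w / (1 + w) = (w^-1 + 1)^-1.
  by field; rewrite !gt_eqF // ?addr_gt0.
apply: is_derive_inverse.
- by apply: filterS near_pos => x x0; exact: fK.
- apply: filterS near_pos => x x0.
  by apply/differentiable_continuous/derivable1_diffP; case: (df x x0).
- exact: df.
- by rewrite gt_eqF // addr_gt0 // invr_gt0.
Qed.

Lemma lambertW_profile k : 0 < k ->
  let w l := lambertW (k * expR l) in
  profile (fun l => w l + 2^-1 * w l ^+ 2) w
          (fun l => w l / (1 + w l)) (fun l => w l / (1 + w l) ^+ 3).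
Proof.
move=> k0 w.
have w0 l : 0 < w l by apply: lambertW_gt0; rewrite mulr_gt0 ?expR_gt0.
have w1 l : 0 < 1 + w l by rewrite addr_gt0.
have dw l : is_derive l 1 w (w l / (1 + w l)) by exact: is_derive_lambertW_exp.
split => l.
- have D := is_deriveD (dw l) (is_deriveZ 2^-1 (is_deriveX 2 (dw l))).
  apply: is_derive_eq D _.
  rewrite /GRing.scale /= expr1; field; exact: lt0r_neq0.
- exact: dw.
- have D1 := is_deriveD (is_derive_cst (1 : R) l 1) (dw l).
  have N : (cst 1 + w) l != 0 by exact: lt0r_neq0 (w1 l).
  apply: is_derive_eq (is_deriveM (dw l) (is_deriveV N D1)) _.
  rewrite /GRing.scale /= add0r -[(cst 1 + w) l]/(1 + w l).
  by field; exact: lt0r_neq0.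
- by rewrite addr_ge0 ?mulr_ge0 ?sqr_ge0 ?invr_ge0 // ltW.
- by rewrite divr_ge0 ?exprn_ge0 // ltW.
- rewrite ler_wpM2l ?(ltW (w0 l)) // lef_pV2 ?posrE ?exprn_gt0 //.
  by rewrite -[leLHS]expr1 ler_weXn2l // lerDl ltW.
- rewrite ler_pdivrMr // ler_peMr ?(ltW (w0 l)) //.
  by rewrite lerDl ltW.
Qed.

End Lambert.

(** * Strong convexity, minimizers and condition numbers *)

Section StrongConvexity.
Context (R : realType) (m : nat).
Implicit Types (J : 'rV[R]_m.+1 -> R) (g h u v : 'rV[R]_m.+1) (H : 'M[R]_m.+1).

Lemma sqnorm2Z k h : sqnorm2 (k *: h) = k ^+ 2 * sqnorm2 h.
Proof. by rewrite /sqnorm2 mulr_sumr; apply: eq_bigr => j _; rewrite mxE exprMn. Qed.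

Lemma sqnorm2_gt0 h : h != 0 -> 0 < sqnorm2 h.
Proof.
move=> h0; rewrite lt_neqAle sumr_ge0 => [|j _]; last exact: sqr_ge0.
rewrite andbT eq_sym; apply: contra h0 => /eqP/psumr_eq0P E.
apply/eqP/rowP => j; rewrite mxE; apply/eqP; rewrite -sqrf_eq0; apply/eqP.
by apply: E => // i _; exact: sqr_ge0.
Qed.

(** Weighting the inequality at p = t g + (1 - t) h towards g and towards h by t
    and 1 - t cancels the linear terms, and
    t (1 - t)^2 + (1 - t) t^2 = t (1 - t). *)
Lemma strongly_convex_first_order (gamma : R) J (dJ : 'I_m.+1 -> 'rV[R]_m.+1 -> R) :
  (forall g h, J g + pairing (dJ ^~ g) h + gamma / 2 * sqnorm2 h <= J (g + h)) ->
  strongly_convex gamma J.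
Proof.
move=> H g h t /andP[t0 t1]; set p := t *: g + (1 - t) *: h.
have Hg := H p ((1 - t) *: (g - h)); have Hh := H p (- t *: (g - h)).
have Eg : p + (1 - t) *: (g - h) = g.
  by apply/rowP => j; rewrite !mxE; ring.
have Eh : p + - t *: (g - h) = h.
  by apply/rowP => j; rewrite !mxE; ring.
rewrite Eg pairingZ sqnorm2Z in Hg; rewrite Eh pairingZ sqnorm2Z in Hh.
have t1' : 0 <= 1 - t by rewrite subr_ge0.
have := lerD (ler_wpM2l t0 Hg) (ler_wpM2l t1' Hh).
rewrite -subr_ge0 => K; rewrite -subr_ge0; apply: le_trans K _.
by rewrite le_eqVlt; apply/orP; left; apply/eqP; field.
Qed.

(** The midpoint of two distinct minimizers would have a smaller value. *)
Lemma strongly_convex_minimizer_unique (gamma : R) J g h : 0 < gamma ->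
  strongly_convex gamma J -> global_minimizer J g -> global_minimizer J h -> g = h.
Proof.
move=> gamma0 sc mg mh; apply/eqP; rewrite -subr_eq0; apply/negPn/negP => gh0.
have half : 0 <= (2^-1 : R) <= 1 by lra.
have := sc g h 2^-1 half.
have := mg (2^-1 *: g + (1 - 2^-1) *: h).
have := mh g; have := mg h.
have : 0 < gamma * sqnorm2 (g - h) by rewrite mulr_gt0 // sqnorm2_gt0.
set N := sqnorm2 _; set P := J (_ + _) => *.
have : gamma / 2 * 2^-1 * (1 - 2^-1) * N = gamma * N / 8 by field.
lra.
Qed.

Lemma minimizer_critical J (dJ : 'I_m.+1 -> 'rV[R]_m.+1 -> R) g j :
  has_grad J dJ -> global_minimizer J g -> dJ j g = 0.
Proof.
(* Fermat's rule along the j-th coordinate line; [-1, 1] is an arbitrary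
   interval around 0. *)
move=> JdJ mg; pose e : 'rV[R]_m.+1 := delta_mx 0 j.
pose phi (t : R) := J (g + t *: e).
have d t := is_derive_line (JdJ (g + t *: e) e).
have D0 : is_derive (0 : R) 1 phi 0.
  apply: (@derive1_at_min R phi (-1) 1 0) => //.
  - by rewrite in_itv /= ltrN10 ltr01.
  - by move=> t _; rewrite /phi scale0r addr0; exact: mg.
have [_ D] := d 0; case: D0 => _; rewrite D scale0r addr0 => E.
rewrite -[RHS]E /pairing (bigD1 j) //= big1 => [|i ij].
  by rewrite addr0 mxE !eqxx mul1r.
by rewrite mxE (negPf ij) andbF mul0r.
Qed.

Lemma coercive_minimizer J (k K : R) : continuous J -> 0 < k ->
  (forall g, k * `|g| - K <= J g) -> exists g, global_minimizer J g.
Proof.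
move=> Jc k0 coer; pose S := [set g | J g <= J 0].
have S0 : S !=set0 by exists 0; rewrite /S /=.
have Sc : compact S.
  apply: bounded_closed_compact.
    exists ((J 0 + K) / k); split; first exact: num_real.
    move=> M MK g /= gS; apply: le_trans (ltW MK).
    by rewrite ler_pdivlMr // mulrC -lerBlDr; apply: le_trans (coer g) gS.
  rewrite (_ : S = J @^-1` [set x | x <= J 0]) //.
  by apply: closed_comp => [x _|]; [exact: Jc | exact: closed_le].
have [g gS mg] := EVT_min_rV S0 Sc (continuous_subspaceT Jc).
exists g => h; have [hS|hS] := leP (J h) (J 0).
  by apply: mg; rewrite inE.
by apply: le_trans (ltW hS); move: gS; rewrite inE.
Qed.

Lemma quadratic_pairing H v :
  (v *m H *m v^T) 0 0 = pairing (fun i => pairing (H i) v) v.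
Proof.
rewrite -mulmxA mxE /pairing; apply: eq_bigr => i _; congr (_ * _).
by rewrite mxE; apply: eq_bigr => j _; rewrite mxE mulrC.
Qed.

(** Testing the form on an eigenvector places every eigenvalue in [lo, hi].  When
    the real spectrum is empty, its supremum is 0 by convention, and the
    quotient 0 satisfies the bound as well. *)
Lemma cond_number_le H (lo hi : R) : 0 < lo -> 0 <= hi ->
  (forall v, lo * sqnorm2 v <= (v *m H *m v^T) 0 0 <= hi * sqnorm2 v) ->
  cond_number H <= hi / lo.
Proof.
move=> lo0 hi0 bnd.
have eig a : eigenvalue H a -> lo <= a <= hi.
  move=> /eigenvalueP[v Hv v0]; have := bnd v; rewrite Hv -scalemxAl mxE.
  have -> : (v *m v^T) 0 0 = sqnorm2 v.
    by rewrite mxE; apply: eq_bigr => j _; rewrite mxE expr2.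
  by rewrite !ler_pM2r ?sqnorm2_gt0.
rewrite /cond_number /lambda_max /lambda_min; set E := [set a : R | _].
have [->|E0] := eqVneq E set0; first by rewrite sup0 mul0r divr_ge0 // ltW.
have {E0} E0 : E !=set0 by apply/set0P.
have supE : sup E <= hi by apply: ge_sup => // a /eig /andP[].
have infE : lo <= inf E by apply: lb_le_inf => // a /eig /andP[].
apply: ler_pM => //; last by rewrite lef_pV2 ?posrE // (lt_le_trans lo0).
  have [a Ea] := E0; apply: (@le_trans _ _ a).
    by have /andP[/(lt_le_trans lo0)/ltW] := eig a Ea.
  by apply: ub_le_sup => //; exists hi => b /eig /andP[].
by rewrite invr_ge0 (le_trans (ltW lo0)).
Qed.

End StrongConvexity.

Section Extrema.
Context (R : realType) (m : nat) (f : 'I_m.+1 -> R).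

Lemma fmin_le j : fmin f <= f j.
Proof. exact: bigmin_le. Qed.

Lemma fmax_ge j : f j <= fmax f.
Proof. exact: le_bigmax. Qed.

Lemma fmin_gt0 : (forall j, 0 < f j) -> 0 < fmin f.
Proof. by move=> f0; apply/lt_bigmin. Qed.

End Extrema.

(** * The penalized objective for a general profile *)

Section PenalizedObjective.
Context (R : realType) (X : ptopologicalType).
Variable mu : {finite_measure set (borel X) -> \bar R}.
Context (m : nat) (a : X -> 'rV[R]_m.+1) (beta : 'I_m.+1 -> R) (eps rho : R).
Hypothesis a_ge0 : forall x j, 0 <= a x 0 j.
Hypothesis a_cont : forall j, continuous (fun x => a x 0 j).
Hypothesis beta_gt0 : forall j, 0 < beta j.
Hypothesis eps_gt0 : 0 < eps.
Hypothesis rho_gt0 : 0 < rho.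
Context (A A1 A2 A3 : R -> R).
Hypothesis prof : profile A A1 A2 A3.
Implicit Types (u v h g : 'rV[R]_m.+1) (i j : 'I_m.+1).

Local Notation T := (transport beta eps A).
Local Notation T1 := (transport_grad beta eps A1).
Local Notation T2 := (transport_hess beta eps A1 A2).

Definition penalty g : R := \sum_j beta j * (g 0 j ^+ 2 / (2 * rho) - g 0 j).
Definition objective g : R := shift_int mu a T g + penalty g.
Definition objective_gradient j g : R :=
  shift_int mu a (T1 j) g + beta j * (g 0 j / rho - 1).
Definition objective_hessian i j g : R :=
  shift_int mu a (T2 i j) g + (i == j)%:R * (beta j / rho).

Let tT : tame T. Proof. exact: (tame_transport beta_gt0 eps_gt0 prof). Qed.
Let tT1 j : tame (T1 j). Proof. exact: (tame_transport_grad beta_gt0 eps_gt0 prof). Qed.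
Let tT2 i j : tame (T2 i j).
Proof. exact: (tame_transport_hess beta_gt0 eps_gt0 prof). Qed.
Let gT : has_grad T T1. Proof. exact: (has_grad_transport eps beta_gt0 prof). Qed.
Let gT1 j : has_grad (T1 j) (T2 ^~ j).
Proof. exact: (has_grad_transport_grad eps beta_gt0 prof). Qed.

(** The penalty is quadratic, so the expansion is exact. *)
Lemma penalty_expansion g h : penalty (g + h) = penalty g +
  pairing (fun j => beta j * (g 0 j / rho - 1)) h +
  \sum_j beta j / (2 * rho) * h 0 j ^+ 2.
Proof.
rewrite /penalty /pairing -!big_split /=; apply: eq_bigr => j _; rewrite mxE.
by field; exact: lt0r_neq0.
Qed.

Lemma penalty_curvature h :
  fmin beta / rho / 2 * sqnorm2 h <= \sum_j beta j / (2 * rho) * h 0 j ^+ 2.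
Proof.
rewrite /sqnorm2 mulr_sumr; apply: ler_sum => j _; rewrite ler_wpM2r ?sqr_ge0 //.
by rewrite -mulrA -invfM [2 * _]mulrC ler_wpM2r ?fmin_le // invr_ge0 mulr_ge0 // ltW.
Qed.

Lemma objective_taylor g : taylor1 objective (objective_gradient ^~ g) g.
Proof.
apply: taylor1D; first exact: shift_int_taylor1.
exists (\sum_j beta j / (2 * rho)) => h _.
rewrite penalty_expansion; set p := pairing _ _; set s := \sum_j _ * h 0 j ^+ 2.
have -> : penalty g + p + s - penalty g - p = s by ring.
have b0 j : 0 <= beta j / (2 * rho) by rewrite divr_ge0 ?mulr_ge0 // ltW.
rewrite ger0_norm; last by apply: sumr_ge0 => j _; rewrite mulr_ge0 ?sqr_ge0.
rewrite mulr_suml; apply: ler_sum => j _; rewrite ler_wpM2l //.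
by rewrite -real_normK ?num_real // lerXn2r ?nnegrE ?normr_ge0 ?coord_le_norm.
Qed.

Lemma objective_gradient_taylor j g :
  taylor1 (objective_gradient j) (fun i => objective_hessian i j g) g.
Proof.
apply: taylor1D; first exact: shift_int_taylor1.
exists 0 => h _; rewrite mul0r.
have -> : pairing (fun i => (i == j)%:R * (beta j / rho)) h = beta j / rho * h 0 j.
  rewrite /pairing (bigD1 j) //= eqxx big1 => [|i /negPf ->].
    by rewrite addr0 mul1r mulrC.
  by rewrite mul0r mulr0.
by rewrite mxE [X in `|X|](_ : _ = 0) ?normr0 //; ring.
Qed.

Lemma has_grad_objective : has_grad objective objective_gradient.
Proof. exact: has_grad_of_taylor1 objective_taylor. Qed.

Lemma objective_first_order g h :
  objective g + pairing (objective_gradient ^~ g) h + fmin beta / rho / 2 * sqnorm2 h <=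
  objective (g + h).
Proof.
have : shift_int mu a T g + pairing (fun j => shift_int mu a (T1 j) g) h <=
    shift_int mu a T (g + h).
  rewrite pairing_shift_int // -shift_intD //; last exact: tame_pairing.
  apply: shift_int_le => // [|x]; first by apply: tameD => //; exact: tame_pairing.
  rewrite [g + h - a x]addrAC.
  apply: (first_order_convex _ gT gT1) => v.
  exact: (transport_hess_ge0 beta_gt0 eps_gt0 prof).
move=> transD; rewrite /objective /objective_gradient pairingD addrACA -[leLHS]addrA.
apply: lerD; first exact: transD.
by rewrite penalty_expansion; apply: lerD; last exact: penalty_curvature.
Qed.

Lemma objective_strongly_convex : strongly_convex (fmin beta / rho) objective.
Proof. exact: strongly_convex_first_order objective_first_order. Qed.

(** The transport part is nonnegative, and the penalty grows at least linearly:
    the square of (|t| - 2 rho), divided by 2 rho, is nonnegative, which says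
    t^2 / (2 rho) - t >= |t| - 2 rho. *)
Lemma objective_has_minimizer : exists g, global_minimizer objective g.
Proof.
apply: (@coercive_minimizer _ _ objective (fmin beta) (2 * rho * \sum_j beta j)).
- by move=> g; apply/differentiable_continuous;
    case: (taylor1_diff (objective_taylor g)).
- exact: fmin_gt0.
move=> g; apply: (@le_trans _ _ (penalty g)); last first.
  by rewrite lerDr; apply: Rintegral_ge0 => x _; exact: profile_ge0 prof _.
rewrite lerBlDr; apply: (@le_trans _ _ (\sum_j beta j * `|g 0 j|)).
  apply: (@le_trans _ _ (fmin beta * \sum_j `|g 0 j|)).
    by rewrite ler_wpM2l ?norm_le_sum_coord // ltW // fmin_gt0.
  by rewrite mulr_sumr; apply: ler_sum => j _; rewrite ler_wpM2r ?fmin_le.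
rewrite /penalty mulr_sumr -big_split /=; apply: ler_sum => j _.
rewrite [2 * rho * _]mulrC -mulrDr ler_wpM2l ?(ltW (beta_gt0 j)) //.
have : 0 <= (`|g 0 j| - 2 * rho) ^+ 2 / (2 * rho).
  by rewrite divr_ge0 ?sqr_ge0 // mulr_ge0 // ltW.
have -> : (`|g 0 j| - 2 * rho) ^+ 2 / (2 * rho) =
    g 0 j ^+ 2 / (2 * rho) - 2 * `|g 0 j| + 2 * rho.
  rewrite -[g 0 j ^+ 2]real_normK ?num_real //; field; exact: lt0r_neq0.
have := ler_norm (g 0 j); lra.
Qed.

Lemma partial_objective j : partial objective j = objective_gradient j.
Proof.
apply/funext => g; rewrite /partial.
have [_ ->] := taylor1_diff (objective_taylor g).
rewrite /pairing (bigD1 j) //= big1 => [|i ij].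
  by rewrite addr0 mxE !eqxx mul1r.
by rewrite mxE (negPf ij) andbF mul0r.
Qed.

Lemma hessian_objective g i j : hessian objective g i j = objective_hessian i j g.
Proof.
rewrite mxE partial_objective /partial.
have [_ ->] := taylor1_diff (objective_gradient_taylor j g).
rewrite /pairing (bigD1 i) //= big1 => [|k ki].
  by rewrite addr0 mxE !eqxx mul1r.
by rewrite mxE (negPf ki) andbF mul0r.
Qed.

Lemma objective_twice_differentiable g : twice_differentiable objective g.
Proof.
split; first by apply: filterE => h; case: (taylor1_diff (objective_taylor h)).
(* Differentiability into row vectors reduces to that of the coordinates. *)
have -> : gradient objective = \sum_j (fun g => objective_gradient j g *: delta_mx 0 j).
  apply/funext => h; apply/rowP => j; rewrite mxE partial_objective fct_sumE.
  rewrite summxE (bigD1 j) //= big1 => [|i ij].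
    by rewrite !mxE !eqxx mulr1 addr0.
  by rewrite !mxE (eq_sym j) (negPf ij) andbF mulr0.
apply: differentiable_sum => j; apply: differentiableZl.
by case: (taylor1_diff (objective_gradient_taylor j g)).
Qed.

Lemma hessian_quadratic g v : (v *m hessian objective g *m v^T) 0 0 =
  shift_int mu a (fun u => pairing (fun i => pairing (fun j => T2 i j u) v) v) g +
  \sum_j beta j / rho * v 0 j ^+ 2.
Proof.
rewrite quadratic_pairing -pairing_shift_int // => [|i]; last exact: tame_pairing.
have -> : \sum_j beta j / rho * v 0 j ^+ 2 =
    pairing (fun i => pairing (fun j => (i == j)%:R * (beta j / rho)) v) v.
  apply: eq_bigr => i _; rewrite /pairing (bigD1 i) //= eqxx big1 => [|j].
    by rewrite addr0 mul1r expr2; ring.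
  by rewrite eq_sym => /negPf ->; rewrite mul0r mulr0.
rewrite -pairingD; apply: eq_bigr => i _; congr (_ * _).
rewrite -pairing_shift_int // -pairingD; apply: eq_bigr => j _.
by rewrite hessian_objective.
Qed.

Lemma hessian_ge g v :
  fmin beta / rho * sqnorm2 v <= (v *m hessian objective g *m v^T) 0 0.
Proof.
rewrite hessian_quadratic -[leLHS]add0r; apply: lerD.
  by apply: Rintegral_ge0 => x _; exact: (transport_hess_ge0 beta_gt0 eps_gt0 prof).
rewrite /sqnorm2 mulr_sumr; apply: ler_sum => j _; rewrite ler_wpM2r ?sqr_ge0 //.
by rewrite ler_wpM2r ?fmin_le // invr_ge0 ltW.
Qed.

Lemma hessian_sym_posdef g : sym_posdef (hessian objective g).
Proof.
split; last first.
  move=> v v0; apply: lt_le_trans (hessian_ge g v).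
  by rewrite mulr_gt0 ?sqnorm2_gt0 // divr_gt0 // fmin_gt0.
apply/matrixP => i j; rewrite mxE !hessian_objective /objective_hessian.
rewrite (_ : T2 j i = T2 i j); last by apply/funext => u; exact: transport_hess_sym.
by rewrite eq_sym; case: eqVneq => [->|]//=; rewrite !mul0r.
Qed.

(** Criticality replaces the gradient of the transport part, which bounds its
    Hessian, by beta_j (1 - g_j / rho).  As that gradient is nonnegative, so is
    rho - g_j, and the diagonal entries can be bounded factor by factor. *)
Lemma hessian_le g v : global_minimizer objective g ->
  (v *m hessian objective g *m v^T) 0 0 <=
  fmax beta / rho * (1 + fmax (fun k => rho - g 0 k) / eps) * sqnorm2 v.
Proof.
move=> mg; rewrite hessian_quadratic.
have S j : shift_int mu a (T1 j) g = beta j / rho * (rho - g 0 j).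
  have /eqP := minimizer_critical j has_grad_objective mg.
  rewrite /objective_gradient addr_eq0 => /eqP ->; field; exact: lt0r_neq0.
have S0 j : 0 <= rho - g 0 j.
  have : 0 <= shift_int mu a (T1 j) g.
    by apply: Rintegral_ge0 => x _; exact: (transport_grad_ge0 beta_gt0 eps_gt0 prof).
  by rewrite S pmulr_rge0 // divr_gt0.
have tv j : tame (fun u => T1 j u * v 0 j ^+ 2).
  exact: tameM (tT1 j) (tame_cst _ _).
have : shift_int mu a (fun u => pairing (fun i => pairing (fun j => T2 i j u) v) v) g
    <= shift_int mu a (fun u => eps^-1 * \sum_j T1 j u * v 0 j ^+ 2) g.
  apply: shift_int_le => // [||x].
  - by do 2! [apply: tame_pairing => ?].
  - by apply: tameM; [exact: tame_cst | exact: tame_sum].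
  by rewrite /= [leRHS]mulrC; exact: (transport_hess_le beta eps_gt0 prof).
rewrite shift_intZ //; last exact: tame_sum.
have -> : shift_int mu a (fun u => \sum_j T1 j u * v 0 j ^+ 2) g =
    \sum_j shift_int mu a (fun u => T1 j u * v 0 j ^+ 2) g.
  exact: shift_int_sum.
move=> H; apply: le_trans (lerD H (lexx _)) _.
rewrite /sqnorm2 !mulr_sumr -big_split /=; apply: ler_sum => j _.
have -> : shift_int mu a (fun u => T1 j u * v 0 j ^+ 2) g =
    v 0 j ^+ 2 * shift_int mu a (T1 j) g.
  rewrite -shift_intZ //; apply: eq_Rintegral => x _; exact: mulrC.
rewrite S.
have -> : eps^-1 * (v 0 j ^+ 2 * (beta j / rho * (rho - g 0 j))) +
  beta j / rho * v 0 j ^+ 2 =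
  beta j / rho * (1 + (rho - g 0 j) / eps) * v 0 j ^+ 2 by ring.
rewrite ler_wpM2r ?sqr_ge0 //.
have r0 : 0 <= rho^-1 by rewrite invr_ge0 ltW.
have e0 : 0 <= eps^-1 by rewrite invr_ge0 ltW.
apply: ler_pM.
- by rewrite mulr_ge0 // ltW.
- by rewrite addr_ge0 // mulr_ge0.
- by rewrite ler_wpM2r ?fmax_ge.
- by rewrite lerD2l ler_wpM2r //; exact: (fmax_ge (fun k => rho - g 0 k)).
Qed.

Lemma objective_cond_number g : global_minimizer objective g ->
  cond_number (hessian objective g) <=
    fmax beta / fmin beta * (1 + fmax (fun k => rho - g 0 k) / eps).
Proof.
move=> mg; set M := 1 + _.
have bmin := fmin_gt0 beta_gt0.
have lo0 : 0 < fmin beta / rho by rewrite divr_gt0.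
(* The upper constant is nonnegative because it dominates the lower one on a
   nonzero vector. *)
pose v : 'rV[R]_m.+1 := delta_mx 0 ord0.
have v0 : 0 < sqnorm2 v.
  apply: sqnorm2_gt0; apply/eqP => /rowP /(_ ord0); rewrite !mxE !eqxx => /eqP.
  by rewrite oner_eq0.
have hi0 : 0 <= fmax beta / rho * M.
  have := le_trans (hessian_ge g v) (hessian_le v mg).
  rewrite ler_pM2r // => /(le_trans _); apply; exact: ltW.
have -> : fmax beta / fmin beta * M = fmax beta / rho * M / (fmin beta / rho).
  by field; rewrite !lt0r_neq0.
apply: cond_number_le => // w; apply/andP; split; first exact: hessian_ge.
exact: hessian_le.
Qed.

Lemma objective_well_conditioned :
  [/\ strongly_convex (fmin beta / rho) objective,
      (exists! g, global_minimizer objective g) &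
      forall g, global_minimizer objective g ->
        [/\ twice_differentiable objective g,
            sym_posdef (hessian objective g) &
            cond_number (hessian objective g) <=
              fmax beta / fmin beta * (1 + fmax (fun k => rho - g 0 k) / eps)]].
Proof.
split; first exact: objective_strongly_convex.
- have [g mg] := objective_has_minimizer; exists g; split => // h mh.
  apply: strongly_convex_minimizer_unique objective_strongly_convex mg mh.
  by rewrite divr_gt0 // fmin_gt0.
- move=> g mg; split; first exact: objective_twice_differentiable.
    exact: hessian_sym_posdef.
  exact: objective_cond_number.
Qed.

End PenalizedObjective.

(** * The semi-dual objective of unbalanced transport *)

Section SemiDualObjective.
Context (R : realType) (X : ptopologicalType) (Y : topologicalType).
Variable mu : {finite_measure set (borel X) -> \bar R}.
Context (m : nat) (y : 'I_m.+1 -> Y) (beta : 'I_m.+1 -> R).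
Context (c : X -> Y -> R) (eps rho1 rho2 : R).
Hypothesis beta_gt0 : forall j, 0 < beta j.
Hypothesis c_ge0 : forall x y, 0 <= c x y.
Hypothesis c_cont : continuous (fun p : X * Y => c p.1 p.2).
Hypothesis eps_gt0 : 0 < eps.
Hypothesis rho1_gt0 : 0 < rho1.

Definition cost_row (x : X) : 'rV[R]_m.+1 := \row_j c x (y j).

Lemma cost_row_ge0 x j : 0 <= cost_row x 0 j.
Proof. by rewrite mxE. Qed.

Lemma cost_row_cont j : continuous (fun x => cost_row x 0 j).
Proof.
under eq_fun do rewrite mxE.
move=> x; apply: (@continuous_comp _ _ _ (fun x => (x, y j))
  (fun p : X * Y => c p.1 p.2)); last exact: c_cont.
by apply: (cvg_pair (G := nbhs x) (H := nbhs (y j))); [exact: cvg_id | exact: cvg_cst].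
Qed.

Lemma Z_partition_fun x g :
  Z_ y beta c eps x g = partition_fun beta eps (g - cost_row x).
Proof. by apply: eq_bigr => j _; rewrite !mxE. Qed.

(** The constant [k] in front of the integral is absorbed into the profile, so
    that both divergences become instances of [objective]. *)
Lemma J_trans_shift_int (k : R) (A A1 A2 A3 : R -> R) (F : R -> R) g :
  profile A A1 A2 A3 -> (forall l, F (expR l) = A l) ->
  k * \int[mu]_x F (Z_ y beta c eps x g) =
  shift_int mu cost_row (transport beta eps (fun l => k * A l)) g.
Proof.
move=> prof FA.
have tA := tame_transport beta_gt0 eps_gt0 prof.
have -> : shift_int mu cost_row (transport beta eps (fun l => k * A l)) g =
    k * shift_int mu cost_row (transport beta eps A) g.
  by rewrite -(shift_intZ _ cost_row_ge0 cost_row_cont _ _ tA).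
congr (_ * _); apply: eq_Rintegral => x _.
by rewrite Z_partition_fun /transport -FA /lse lnK // posrE partition_fun_gt0.
Qed.

Lemma J_semidual_objective s : exists A A1 A2 A3, profile A A1 A2 A3 /\
  J_semidual mu y beta c eps rho1 rho2 s =
  objective mu cost_row beta eps rho2 A.
Proof.
case: s.
- have sum_gt0 : 0 < eps + rho1 by exact: addr_gt0.
  have alpha01 : 0 <= eps / (eps + rho1) <= 1.
    rewrite divr_ge0 ?(ltW eps_gt0) ?(ltW sum_gt0) //=.
    by rewrite ler_pdivrMr // mul1r lerDl ltW.
  have P := exp_profile alpha01.
  have k0 : 0 <= rho1 + eps by rewrite addrC ltW.
  do 4!eexists; split; first exact: profileZ k0 P.
  apply/funext => g; congr (_ + _).
  apply: (J_trans_shift_int (F := fun z => z `^ (eps / (eps + rho1))) _ _ P) => l.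
  by rewrite /powR gt_eqF ?expR_gt0 // expRK.
- have k0 : 0 < rho1 / eps * expR (rho1 / eps) by rewrite mulr_gt0 ?expR_gt0 ?divr_gt0.
  have P := lambertW_profile k0.
  have c0 : 0 <= eps ^+ 2 / rho1 by rewrite divr_ge0 ?sqr_ge0 // ltW.
  do 4!eexists; split; first exact: profileZ c0 P.
  apply/funext => g; congr (_ + _).
  exact: (J_trans_shift_int (F := fun z =>
    let w := lambertW (rho1 / eps * expR (rho1 / eps) * z) in w + 2^-1 * w ^+ 2)
    _ _ P).
Qed.

End SemiDualObjective.

Theorem corollary6 (R : realType) (X : ptopologicalType) (Y : topologicalType)
  (polishX : polish R X) (polishY : polish R Y)
  (mu : {finite_measure set (borel X) -> \bar R})
  (m : nat) (y : 'I_m.+1 -> Y) (beta : 'I_m.+1 -> R) (b B : R)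
  (b_gt0 : 0 < b) (b_le_B : b <= B)
  (beta_gt0 : forall j, 0 < beta j)
  (beta_bounds : forall j, b / m.+1%:R <= beta j <= B / m.+1%:R)
  (c : X -> Y -> R)
  (c_ge0 : forall x y, 0 <= c x y)
  (c_cont : continuous (fun p : X * Y => c p.1 p.2))
  (eps rho1 rho2 : R)
  (eps_gt0 : 0 < eps) (rho1_gt0 : 0 < rho1) (rho2_gt0 : 0 < rho2)
  (s : source_divergence) :
  let J := J_semidual mu y beta c eps rho1 rho2 s in
  [/\ strongly_convex (fmin beta / rho2) J,
      (exists! g : 'rV[R]_m.+1, global_minimizer J g) &
      forall g : 'rV[R]_m.+1, global_minimizer J g ->
        [/\ twice_differentiable J g,
            sym_posdef (hessian J g) &
            cond_number (hessian J g) <=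
              fmax beta / fmin beta * (1 + fmax (fun k => rho2 - g 0 k) / eps)]].
Proof.
rewrite /=; have [A [A1 [A2 [A3 [prof ->]]]]] := J_semidual_objective mu y rho2
  beta_gt0 c_ge0 c_cont eps_gt0 rho1_gt0 s.
apply: objective_well_conditioned prof => //; last exact: cost_row_cont.
by move=> x j; exact: cost_row_ge0.
Qed.
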